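(* Let $k\ge 4$ and let $w$ be a minimal uncompletable word for $S_k$. Let $p,q\in\{u,v\}$ be two consecutive occurrences in $w$ ($p$ before $q$), with sets of forbidden local positions $F_p,F_q\subseteq\{0,\dots,k-1\}$. If $|F_p|>|F_q|$, then one of the following holds: (i) $p$ and $q$ are both occurrences of $u$, $F_p=\{0,k-j,k-j+1,\dots,k-1\}$ and $F_q=\{1,2,\dots,j\}$ for some $1\le j\le k-2$; (ii) $p$ is an occurrence of $v$, $q$ is an occurrence of $u$, these occurrences overlap, $F_p=\{0,k-1\}$ and $F_q=\{1\}$; (iii) $p$ is an occurrence of $u$, $q$ is an occurrence of $v$, $F_q=\{0,1,\dots,i\}\cup\{j,j+1,\dots,k-1\}$ and $F_p=\{0\}\cup\{j-i-1,\dots,k-1\}$ for some integers $0\le i<j\le k$ with $j\ne i+1$ (where $\{j,\dots,k-1\}$ is empty if $j=k$), and the number of letters strictly between these two occurrences is congruent to $k-1-i$ modulo $k$.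
   Context: $\Sigma=\{a,b\}$. $S_k=\left(\Sigma^k\setminus\{ba^{k-1},b^{k-1}a\}\right)\cup\left(\Sigma^{k-1}\setminus\{a^{k-1},b^{k-1}\}\right)$, $u=ba^{k-1}$, $v=b^{k-1}a$. $\mathit{Fact}(S^* )$ and $\mathit{Pref}(S^* )$ are the sets of factors and of prefixes of words in $S^*$. A word $w\notin\mathit{Fact}(S_k^* )$ is uncompletable; a minimal uncompletable word is one of minimal length. For $w=w_1\cdots w_n$, $w[i..j]=w_i\cdots w_j$ (empty if $i>j$). A position $j$, $0\le j\le n-1$, is forbidden in $w$ if $w[j+1..n]\notin\mathit{Pref}(S_k^* )$. An occurrence of $p\in\{u,v\}$ in $w$ is an index $s$ with $w[s+1..s+k]=p$; local position $i\in\{0,\dots,k-1\}$ of the occurrence is the position $s+i$ of $w$, and it is forbidden in the occurrence if $s+i$ is forbidden in $w$. Two occurrences of words from $\{u,v\}$ starting at $s<t$ overlap if $t<s+k$; they are consecutive if either they overlap or they are the only occurrences of $u$ or $v$ lying inside the factor $w[s+1..t+k]$. *)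

(* Defs.v *)
(* Alphabet {a,b} encoded as bool: a = false, b = true. *)
From mathcomp Require Import all_boot all_order all_algebra.
Set Implicit Arguments. Unset Strict Implicit. Unset Printing Implicit Defensive.

Notation word := (seq bool).
Notation la := false.
Notation lb := true.

Definition u (k : nat) : word := lb :: nseq k.-1 la.
Definition v (k : nat) : word := rcons (nseq k.-1 lb) la.

Definition inS (k : nat) (x : word) : bool :=
  ((size x == k) && (x != u k) && (x != v k))
  || ((size x == k.-1) && (x != nseq k.-1 la) && (x != nseq k.-1 lb)).

Definition inStar (k : nat) (x : word) : Prop :=
  exists ws : seq word, all (inS k) ws /\ flatten ws = x.

Definition inPref (k : nat) (x : word) : Prop := exists t, inStar k (x ++ t).
Definition inFact (k : nat) (x : word) : Prop := exists s t, inStar k (s ++ x ++ t).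

Definition uncompletable (k : nat) (w : word) : Prop := ~ inFact k w.

Definition min_uncompletable (k : nat) (w : word) : Prop :=
  uncompletable k w /\ forall w', uncompletable k w' -> size w <= size w'.

Definition forbidden (k : nat) (w : word) (j : nat) : Prop :=
  j < size w /\ ~ inPref k (drop j w).

Definition occ (k : nat) (w p : word) (s : nat) : Prop :=
  s + k <= size w /\ take k (drop s w) = p.

Definition occUV (k : nat) (w : word) (s : nat) : Prop :=
  occ k w (u k) s \/ occ k w (v k) s.

Definition consecutive (k : nat) (w : word) (s t : nat) : Prop :=
  [/\ occUV k w s, occUV k w t, s < t &
    (t < s + k \/
     forall r, occUV k w r -> s <= r -> r + k <= t + k -> r = s \/ r = t)].

(* Main.v *)
Require Import Defs.
From mathcomp Require Import all_boot all_order all_algebra.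
From mathcomp Require Import zify.

(** Away from the occurrences of [u] and [v], a forbidden position [j] forces
    [j + k] to be forbidden, and also [j + k - 1] unless the [k - 1] letters after
    [j] are equal. Reading residue classes modulo [k] from right to left, the
    forbidden set can only shrink between two disjoint consecutive occurrences,
    and only the starting position of the first one can be gained. Hence
    [#|Fq| < #|Fp|] means that nothing is lost: every cyclic run of [Fq] must
    begin in a class whose positions in between are all followed by [k - 1] equal
    letters. The letters around the two occurrences leave room for exactly one
    run when the first one is [u]; when it is [v] there is no run, [Fp] is [{0}],
    and [w] could be cut after [v], against minimality. *)

Set Implicit Arguments.
Unset Strict Implicit.
Unset Printing Implicit Defensive.

(** * Prefixes of $S_k^*$: block recursion, decidability, forbidden positions *)

(** Both excluded words of length [k] end in [a], so padding with [b] on the right gives a block of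
    $S_k$. Dually, both begin with [b], which allows padding with [a] on the left. *)
Lemma inS_last (k : nat) (x : word) :
  1 < k -> size x = k -> last lb x = lb -> inS k x.
Proof.
case: k => [|[|k]] // _ sx lx; rewrite /inS sx eqxx /=.
suff [-> ->]: x != u k.+2 /\ x != v k.+2 by [].
split; apply: contra_eqN lx => /eqP->; last by rewrite last_rcons.
by rewrite /u /= (_ : last _ _ = la) //; elim: k {sx}.
Qed.

Lemma inS_head (k : nat) (x : word) :
  1 < k -> size x = k -> head lb x = la -> inS k x.
Proof.
case: k => [|[|k]] // _ sx hx; rewrite /inS sx eqxx /=.
suff [-> ->]: x != u k.+2 /\ x != v k.+2 by [].
by split; apply: contra_eqN hx => /eqP->.
Qed.

Lemma inPref_short (k : nat) (x : word) : 1 < k -> size x < k -> inPref k x.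
Proof.
move=> k1 sx; exists (nseq (k - size x) lb), [:: x ++ nseq (k - size x) lb].
split; last by rewrite /= cats0.
rewrite /= andbT; apply: inS_last => //.
  by rewrite size_cat size_nseq subnKC // ltnW.
have -> : k - size x = (k - size x).-1.+1 by lia.
by rewrite -addn1 nseqD catA last_cat.
Qed.

Lemma inPref_cons (k m : nat) (x : word) :
  inS k (take m x) -> inPref k (drop m x) -> inPref k x.
Proof.
move=> Sx [t [ws [Sws fws]]]; exists t, (take m x :: ws).
by rewrite /= Sx Sws fws catA cat_take_drop.
Qed.

(** The first block of a factorisation has length [k] or [k - 1], and [k <= size x] puts it entirely
    inside [x]. *)
Lemma inPref_step (k : nat) (x : word) : 0 < k -> k <= size x ->
  inPref k x <-> inS k (take k x) /\ inPref k (drop k x) \/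
                 inS k (take k.-1 x) /\ inPref k (drop k.-1 x).
Proof.
move=> k0 kx; split=> [[t [[|y ws] [/= Sws fws]]]|[]]; last 2 first.
- by case; apply: inPref_cons.
- by case; apply: inPref_cons.
- by move/(congr1 size): fws; rewrite size_cat /=; lia.
case/andP: Sws => Sy Sws.
have prefix m : size y = m -> m <= size x ->
    inS k (take m x) /\ inPref k (drop m x).
  move=> sy mx; have : take m (y ++ flatten ws) = take m (x ++ t) by rewrite fws.
  rewrite take_cat -sy ltnn subnn take0 cats0 takel_cat ?sy // => <-.
  split=> //; exists t, ws; split=> //.
  have : drop m (y ++ flatten ws) = drop m (x ++ t) by rewrite fws.
  rewrite -sy drop_size_cat // sy => ->; rewrite drop_cat.
  by case: ltnP => // xm; rewrite (drop_oversize xm) (_ : m - _ = 0) ?drop0 //; lia.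
case/orP: (Sy) => /andP[/andP[/eqP sy _] _].
  by left; apply: prefix.
by right; apply: prefix => //; lia.
Qed.

(** [inPref] quantifies over all completions; the block recursion reduces it to shorter suffixes and
    so decides it. This later makes forbidden sets boolean, hence countable by sums. *)
Lemma inPref_dec (k : nat) (x : word) : 1 < k -> decidable (inPref k x).
Proof.
move=> k1; have [n] := ubnP (size x); elim: n x => // n IHn x.
rewrite ltnS => xn; have [xk|kx] := ltnP (size x) k.
  by left; apply: inPref_short.
have shorter m : 0 < m -> decidable (inPref k (drop m x)).
  by move=> m0; apply: IHn; rewrite size_drop; lia.
have step := @inPref_step k x (ltnW k1) kx.
have [] := @shorter k ltac:(lia); have [] := @shorter k.-1 ltac:(lia).
- move=> p1 p2; case: (boolP (inS k (take k x) || inS k (take k.-1 x))) => S12.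
    by left; apply/step; case/orP: S12; [left | right].
  by right=> /step[] [S _]; rewrite S ?orbT in S12.
- move=> p1 p2; case: (boolP (inS k (take k x))) => S12.
    by left; apply/step; left.
  by right=> /step[] [S //]; rewrite S in S12.
- move=> p1 p2; case: (boolP (inS k (take k.-1 x))) => S12.
    by left; apply/step; right.
  by right=> /step[] [S //]; rewrite S in S12.
- by move=> p1 p2; right=> /step[] [].
Qed.

(** The empty suffix is a prefix, so the bound [j < size w] is automatic. *)
Lemma forbiddenE (k : nat) (w : word) (j : nat) : 0 < k ->
  forbidden k w j <-> ~ inPref k (drop j w).
Proof.
move=> k0; split=> [[]//|nP]; split=> //; rewrite ltnNge; apply/negP => wj.
by apply: nP; rewrite drop_oversize //; exists [::], [::].
Qed.

(** When [k - 1] letters remain after [j], this says that the block of length [k - 1] there is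
    outside $S_k$. *)
Definition homog (k : nat) (w : word) (j : nat) : bool :=
  (take k.-1 (drop j w) == nseq k.-1 la) || (take k.-1 (drop j w) == nseq k.-1 lb).

Definition occUVb (k : nat) (w : word) (j : nat) : bool :=
  (take k (drop j w) == u k) || (take k (drop j w) == v k).

(** Negation of [inPref_step]; decidability turns each negated conjunction into a disjunction. *)
Lemma forbidden_step (k : nat) (w : word) (j : nat) :
  1 < k -> j + k <= size w ->
  forbidden k w j <->
  (occUVb k w j \/ forbidden k w (j + k)) /\
  (homog k w j \/ forbidden k w (j + k.-1)).
Proof.
move=> k1 jw; rewrite !forbiddenE; try lia.
have sx : k <= size (drop j w) by rewrite size_drop; lia.
have := @inPref_step k (drop j w) ltac:(lia) sx.
have -> : inS k (take k (drop j w)) = ~~ occUVb k w j.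
  by rewrite /inS size_takel // eqxx (_ : k == k.-1 = false) ?orbF ?negb_or //; lia.
have -> : inS k (take k.-1 (drop j w)) = ~~ homog k w j.
  rewrite /inS size_takel; last by lia.
  by rewrite eqxx (_ : k.-1 == k = false) ?negb_or //; lia.
rewrite !drop_drop ![_ + j]addnC => ->.
have := @inPref_dec k (drop (j + k) w) k1.
have := @inPref_dec k (drop (j + k.-1) w) k1.
by case: (occUVb k w j); case: (homog k w j) => /= -[] ? [] ?; split; intuition.
Qed.

Lemma forbidden_pred (k : nat) (w : word) : 1 < k ->
  exists F : nat -> bool, forall j, F j <-> forbidden k w j.
Proof.
move=> k1; exists (fun j => ~~ inPref_dec (drop j w) k1) => j.
rewrite forbiddenE; last by lia.
by case: inPref_dec => //= p; split=> // /(_ p).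
Qed.

(** * Uncompletability read off the first [k] positions *)

(** A block straddling the border has at most [k] letters, at least one of them in [y], so fewer
    than [k] in [x]. *)
Lemma inStar_suffix (k : nat) (y x : word) : 0 < k -> inStar k (y ++ x) ->
  exists2 j, j < k & inStar k (drop j x).
Proof.
move=> k0 [ws [Sws]]; elim: ws y Sws => [|z ws IHws] y /=.
  by move=> _ /esym/nilP; rewrite cat_nilp => /andP[_ /nilP->];
    exists 0 => //; exists [::].
case/andP=> Sz Sws fws; case: y fws => [|c y] fws.
  by exists 0 => //; rewrite drop0; exists (z :: ws); rewrite /= Sz Sws.
have zk : size z <= k.
  by case/orP: Sz => /andP[/andP[/eqP-> _] _] //; apply: leq_pred.
have [yz|zy] := ltnP (size y) (size z).
  exists (size z - (size y).+1); first by lia.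
  exists ws; split=> //.
  have /(congr1 (drop (size z))) := fws; rewrite drop_size_cat // => ->.
  by rewrite drop_cat ltnNge yz.
have /(congr1 (drop (size z))) := fws; rewrite drop_size_cat // => fws'.
apply: (IHws (drop (size z) (c :: y))) => //.
by rewrite fws' drop_cat ltnS zy.
Qed.

Lemma uncompletableP (k : nat) (w : word) : 1 < k -> k <= size w ->
  uncompletable k w <-> forall j, j < k -> forbidden k w j.
Proof.
move=> k1 kw; split=> [unc j jk|forb [y [t ywt]]].
  apply/forbiddenE; first by lia.
  (* The [j] letters before the cut are padded on the left to one block of length [k]; since [j < k]
     it begins with [a], hence lies in $S_k$. *)
  move=> [t [ws [Sws fws]]]; apply: unc; exists (nseq (k - j) la), t.
  exists ((nseq (k - j) la ++ take j w) :: ws).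
  rewrite /= Sws fws -!catA [take j w ++ _]catA cat_take_drop andbT; split=> //.
  apply: inS_head => //; first by rewrite size_cat size_nseq size_takel; lia.
  by have -> : k - j = (k - j).-1.+1 by lia.
have [j jk] := @inStar_suffix k y (w ++ t) ltac:(lia) ywt.
rewrite drop_cat (leq_trans jk kw) => Pj.
by have [_ []] := forb j jk; exists t.
Qed.

(** * Occurrences of [v] and the use of minimality *)

Lemma take_drop_take (m j l : nat) (w : word) :
  j + l <= m -> take l (drop j (take m w)) = take l (drop j w).
Proof.
move=> jm; have jm' : j <= m by lia.
by rewrite -{1}[m](subnK jm') -take_drop take_takel //; lia.
Qed.

Lemma occE (k : nat) (w p : word) (s : nat) :
  s + k <= size w -> occ k w p s <-> take k (drop s w) == p.
Proof. by move=> sw; split=> [[_ ->]//|/eqP]. Qed.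

(** Neither [v] nor its prefix $b^{k-1}$ is in $S_k$, so no block can be read at [s]. *)
Lemma forbidden_v (k : nat) (w : word) (s : nat) : 1 < k ->
  occ k w (v k) s -> forbidden k w s.
Proof.
move=> k1 [sw vs]; apply/forbidden_step => //; split; left.
  by rewrite /occUVb vs eqxx orbT.
rewrite /homog -(@take_takel _ k.-1 k) ?leq_pred // vs /v -cats1.
by rewrite take_size_cat ?size_nseq // eqxx orbT.
Qed.

(* Otherwise [w] could be truncated right after this occurrence of [v], whose
   position 0 stays forbidden. *)
Lemma min_uncompletable_v (k : nat) (w : word) (s : nat) : 2 < k ->
  min_uncompletable k w -> occ k w (v k) s -> s + k < size w ->
  exists2 i, 0 < i < k & forbidden k w (s + i).
Proof.
move=> k2 [unc minw] [_ vs] skw; have k1 : 1 < k by lia.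
have [F FP] := @forbidden_pred k w k1.
case: (boolP [exists i : 'I_k, (0 < i) && F (s + i)]).
  by case/existsP=> i /andP[i0 /FP Fi]; exists i; rewrite ?i0 /=.
rewrite negb_exists => /forallP noF.
set w' := take (s + k) w.
have sw' : size w' = s + k by rewrite size_takel // ltnW.
suff unc' : uncompletable k w' by move/minw: unc'; rewrite sw'; lia.
apply/uncompletableP => //; first by lia.
move/uncompletableP: unc => /(_ k1 ltac:(lia)) unc.
(* Induction from right to left. Positions strictly between [s] and [s + k] are not forbidden by
   assumption, [s] stays forbidden because of [v], and for [j < s] both [j + k] and [j + k - 1]
   precede the cut [s + k]. *)
suff trunc n j : s < j + n -> j < s + k -> forbidden k w j -> forbidden k w' j.
  by move=> j jk; apply: (trunc s.+1); [lia | lia | apply: unc].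
elim: n j => [|n IHn] j sj jsk Fj.
  have jk : j - s < k by lia.
  have := noF (Ordinal jk); rewrite /= subnKC; last by lia.
  by move/FP: Fj => ->; lia.
have [sj'|js] := ltnP s j; first by apply: IHn => //; lia.
have [->|nsj] := eqVneq j s.
  apply: forbidden_v => //; split; first by rewrite sw'.
  by rewrite take_drop_take.
apply/forbidden_step => //; first by rewrite sw'; lia.
have /forbidden_step[//||H1 H2] := Fj; first by lia.
rewrite /occUVb /homog /w' !take_drop_take; [split|lia..].
  by case: H1 => [|F1]; [left | right; apply: IHn => //; lia].
by case: H2 => [|F1]; [left | right; apply: IHn => //; lia].
Qed.

(** * Letter-by-letter descriptions of occurrences and homogeneous factors *)

(** Indices start at 0, so letter [n] is the one just after position [n]; the interval is
    half-open. *)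
Definition letters (w : word) (c : bool) (i j : nat) : Prop :=
  forall n, i <= n < j -> nth la w n = c.

Lemma take_dropP (l : nat) (w p : word) (s : nat) :
  size p = l -> s + l <= size w ->
  take l (drop s w) = p <-> forall n, n < l -> nth la w (s + n) = nth la p n.
Proof.
move=> sp sw; split=> [<- n nl|H]; first by rewrite nth_take // nth_drop.
have st : size (take l (drop s w)) = l by rewrite size_takel // size_drop; lia.
apply: (@eq_from_nth _ la); rewrite st // => n nl.
by rewrite nth_take // nth_drop H.
Qed.

Lemma homogP (k : nat) (w : word) (j : nat) : j + k.-1 <= size w ->
  homog k w j -> exists c, letters w c j (j + k.-1).
Proof.
move=> jw /orP[] /eqP/take_dropP; rewrite size_nseq => /(_ erefl jw) H.
  exists la => n jn; have nk : n - j < k.-1 by lia.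
  by have := H _ nk; rewrite nth_nseq nk subnKC //; lia.
exists lb => n jn; have nk : n - j < k.-1 by lia.
by have := H _ nk; rewrite nth_nseq nk subnKC //; lia.
Qed.

Lemma occ_uP (k : nat) (w : word) (s : nat) : 0 < k ->
  occ k w (u k) s <->
  [/\ s + k <= size w, nth la w s = lb & letters w la s.+1 (s + k)].
Proof.
move=> k0; have su : size (u k) = k by rewrite /= size_nseq; lia.
split=> [[sw /take_dropP-/(_ su sw) H]|[sw ws H]].
  split=> //; first by rewrite -[s]addn0 H.
  move=> n sn; have := H (n - s); rewrite subnKC; last by lia.
  move=> ->; last by lia.
  by rewrite -[n - s]prednK /= ?nth_nseq; [case: ifP | lia].
split=> //; apply/take_dropP => // -[|n] nk; first by rewrite addn0.
by rewrite /= nth_nseq H; [case: ifP | lia].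
Qed.

Lemma occ_vP (k : nat) (w : word) (s : nat) : 0 < k ->
  occ k w (v k) s <->
  [/\ s + k <= size w, nth la w (s + k.-1) = la & letters w lb s (s + k.-1)].
Proof.
move=> k0; have sv : size (v k) = k by rewrite size_rcons size_nseq; lia.
have nv n : nth la (v k) n = (n < k.-1).
  by rewrite nth_rcons size_nseq nth_nseq; case: ifP => //; case: ifP.
split=> [[sw /take_dropP-/(_ sv sw) H]|[sw ws H]].
  split=> //; first by rewrite H ?nv; lia.
  move=> n sn; have := H (n - s); rewrite subnKC; last by lia.
  by move=> ->; rewrite ?nv; lia.
split=> //; apply/take_dropP => // n nk; rewrite nv.
by case: ltnP => nk1; [apply: H; lia | rewrite -ws; congr nth; lia].
Qed.

(** * Counting over residue classes *)

(** Only index 0 can contribute to the excess, and by at most one; the other terms then attain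
    equality in a termwise inequality. *)
Lemma sum_excess (n : nat) (f g : nat -> bool) :
  (forall i, 0 < i < n -> f i -> g i) ->
  \sum_(i < n) g i < \sum_(i < n) f i ->
  [/\ f 0, ~~ g 0 & forall i, 0 < i < n -> f i = g i].
Proof.
case: n => [|n] fg; first by rewrite !big_ord0.
rewrite !big_ord_recl /=.
have le : forall i : 'I_n, true ->
    (f (bump 0 i) <= g (bump 0 i) ?= iff (f (bump 0 i) == g (bump 0 i))).
  move=> i _; have /implyP := fg i.+1 (ltn_ord i).
  by rewrite /bump /=; case: (f _); case: (g _).
have [le_sum eq_sum] := leqif_sum le.
move: eq_sum le_sum; set A := \sum_(i < n) _; set B := \sum_(i < n) _.
move=> eq_sum le_sum; case f0: (f 0); case g0: (g 0) => /= lt; try by clear -le_sum lt; lia.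
split=> // -[//|i] ilt; have AB : A == B by clear -le_sum lt; lia.
by move: eq_sum; rewrite AB => /esym/forallP/(_ (Ordinal (ilt : i < n)))/eqP.
Qed.

(** Moving the window by one trades its first index [l] for [l + k], which has the same value. *)
Lemma sum_periodic (k : nat) (Q : nat -> bool) (m n : nat) :
  (forall j, Q (j + k) = Q j) ->
  \sum_(i < k) Q (m + i) = \sum_(i < k) Q (n + i).
Proof.
move=> per; suff shift l : \sum_(i < k) Q (l + i) = \sum_(i < k) Q (0 + i).
  by rewrite shift [RHS]shift.
elim: l => // l <-; case: k per => [|k] per; first by rewrite !big_ord0.
rewrite big_ord_recr [RHS]big_ord_recl [LHS]addnC /= addn0.
congr (_ + _); first by rewrite addSnnS per.
by apply: eq_bigr => i _; rewrite addSnnS.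
Qed.

Lemma card_sum (k : nat) (F : nat -> bool) (A : {set 'I_k}) (s : nat) :
  (forall i : 'I_k, i \in A <-> F (s + i)) -> #|A| = \sum_(i < k) F (s + i).
Proof.
move=> AF; rewrite -sum1_card big_mkcond; apply: eq_bigr => i _.
suff -> : (i \in A) = F (s + i) by case: (F _).
by apply/idP/idP => /AF.
Qed.

Lemma periodic_addM (k : nat) (Q : nat -> bool) (j m : nat) :
  (forall j, Q (j + k) = Q j) -> Q (j + m * k) = Q j.
Proof. by move=> per; elim: m => [|m IHm]; rewrite ?addn0 // mulSnr addnA per. Qed.

(** * Propagation between disjoint occurrences and the periodic set *)

Lemma forbidden_addk (k : nat) (w : word) (j : nat) :
  1 < k -> j + k <= size w -> ~ occUV k w j ->
  forbidden k w j -> forbidden k w (j + k).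
Proof.
move=> k1 jw nocc /forbidden_step[//|//|[]] //.
by case/orP=> /occE oj _; case: nocc; [left | right]; apply: oj.
Qed.

Lemma forbidden_addk1 (k : nat) (w : word) (j : nat) :
  1 < k -> j + k <= size w -> ~~ homog k w j ->
  forbidden k w j -> forbidden k w (j + k.-1).
Proof. by move=> k1 jw nh /forbidden_step[//|//|_ []] // h; rewrite h in nh. Qed.

(* [Q] is the forbidden set of the second occurrence, extended [k]-periodically.
   Going left from [t] to [s], residue classes can only lose forbiddenness; as
   [s] is the only position of its window that may gain it, the strict
   inequality leaves no room for any loss in between. *)
Lemma forbidden_excess (k : nat) (w : word) (s t : nat) (F : nat -> bool) :
  1 < k -> (forall j, F j <-> forbidden k w j) ->
  t + k <= size w -> s + k <= t ->
  (forall j, s < j < t -> ~ occUV k w j) ->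
  \sum_(i < k) F (t + i) < \sum_(i < k) F (s + i) ->
  F s /\ exists Q : nat -> bool,
    [/\ forall j, Q (j + k) = Q j, ~~ Q s,
        forall j, s < j < t + k -> F j = Q j &
        forall i m, 0 < i -> Q (s + i) -> ~~ Q (s + i.-1) ->
          s + i + m * k < t -> homog k w (s + i + m * k)].
Proof.
move=> k1 FP tw st nocc lt.
(* Since [t * k.-1] is congruent to [- t] modulo [k], the index is the residue of [j - t], written
   without truncated subtraction. *)
pose Q j := F (t + (j + t * k.-1) %% k).
have per j : Q (j + k) = Q j by rewrite /Q addnAC modnDr.
have QF j : t <= j < t + k -> Q j = F j.
  move=> jt; rewrite /Q (_ : j + _ = t * k + (j - t)); last by lia.
  by rewrite modnMDl modn_small ?subnKC; lia.
have Fk j : s < j < t -> F j -> F (j + k).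
  move=> jst /FP Fj; apply/FP/forbidden_addk => //; [lia | exact: nocc].
(* Adding [k] repeatedly preserves forbiddenness until the window of [t] is reached. *)
have FQ j : s < j < t + k -> F j -> Q j.
  have [n] := ubnP (t + k - j); elim: n j => // n IHn j jn jst Fj.
  have [tj|jt] := leqP t j; first by rewrite QF //; lia.
  by rewrite -per; apply: IHn; [lia | lia | apply: Fk => //; lia].
have [||Fs Qs FQi] := @sum_excess k (fun i => F (s + i)) (fun i => Q (s + i)).
- by move=> i ik; apply: FQ; lia.
- rewrite (@sum_periodic k Q s t) // (leq_trans _ lt) // ltnS.
  by apply: leq_sum => i _; have ik := ltn_ord i; rewrite QF ?leqnn //; lia.
rewrite addn0 in Fs Qs; split=> //; exists Q.
(* The equality case gives [F = Q] in the first window; beyond it, the value at [j] is inherited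
   from [j - k], which differs from [s] because [Q s] fails. *)
have QFj j : s < j < t + k -> F j = Q j.
  have [n] := ubnP j; elim: n j => // n IHn j jn jst.
  apply/idP/idP; first exact: FQ.
  have [js|sj] := ltnP j (s + k).
    by have := FQi (j - s); rewrite subnKC => [->|] //; lia.
  have jk : j - k + k = j by lia.
  rewrite -{1}jk per => Qj; have jks : j - k != s.
    by apply: contraNneq Qs => <-.
  by rewrite -jk; apply: Fk; [|rewrite IHn]; rewrite ?Qj; lia.
(* At an inhomogeneous position forbiddenness also moves by [k - 1], that is, to the preceding
   residue class, contradicting the start of a run. *)
split=> // i m i0 Qi nQi ist; apply: contraNT nQi => nh.
rewrite -(@periodic_addM k Q _ m.+1) //.
have -> : s + i.-1 + m.+1 * k = s + i + m * k + k.-1.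
  by rewrite mulSn; lia.
rewrite -QFj; last by lia.
apply/FP/forbidden_addk1 => //; first by lia.
by apply/FP; rewrite QFj ?(periodic_addM _ _ per) //; lia.
Qed.

(** With [e] the least true index, a false value met when descending from [k - 1] to [e] would
    produce a second start. *)
Lemma single_run (k : nat) (R : nat -> bool) :
  ~~ R 0 -> R k.-1 ->
  (forall i j, 0 < i < j -> j < k ->
     R i -> ~~ R i.-1 -> R j -> ~~ R j.-1 -> False) ->
  exists e, [/\ 0 < e < k, R e, ~~ R e.-1 & forall i, i < k -> R i = (e <= i)].
Proof.
move=> R0 Rk uniq_start; have k1 : 1 < k.
  by rewrite ltnNge; apply: contra R0 => ?; rewrite (_ : 0 = k.-1) //; lia.
case: (@ex_minnP (fun i => R i)) => [|e Re mine]; first by exists k.-1.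
have e0 : 0 < e by case: e Re R0 {mine} => // ->.
have ek : e <= k.-1 by apply: mine.
have nRe : ~~ R e.-1 by apply/negP => /mine; lia.
exists e; split=> //; first by lia.
move=> i ik; apply/idP/idP => [|ei]; first exact: mine.
suff down n : n <= k.-1 - e -> R (k.-1 - n).
  by rewrite (_ : i = k.-1 - (k.-1 - i)) ?down //; lia.
elim: n => [|n IHn] nk; first by rewrite subn0.
apply/negPn/negP => nR; apply: (uniq_start e (k.-1 - n)) => //; try lia.
by rewrite (_ : _.-1 = k.-1 - n.+1) //; lia.
Qed.

(** * Disjoint occurrences, by the types of the two words *)

(** A homogeneous factor at [s + i] with [0 < i < k] contains the final [a] of [v], so it consists
    of [a] and [i = k - 1]; with the last [b] of [v] it forms an intermediate [u]. So no run starts,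
    only [s] is forbidden in the window, and minimality is contradicted. *)
Lemma consecutive_v (k : nat) (w : word) (s t : nat) (F : nat -> bool) :
  3 < k -> (forall j, F j <-> forbidden k w j) -> min_uncompletable k w ->
  t + k <= size w -> s + k <= t -> occ k w (v k) s ->
  (forall j, s < j < t -> ~ occUV k w j) ->
  \sum_(i < k) F (s + i) <= \sum_(i < k) F (t + i).
Proof.
move=> k3 FP minw tw st ov nocc; rewrite leqNgt; apply/negP.
case/(forbidden_excess _ FP tw st nocc) => [|Fs [Q [per Qs FQ start]]].
  by lia.
have [_ va vb] := (occ_vP w s (ltnW (ltnW (ltnW k3)))).1 ov.
have nostart i : 0 < i < k -> Q (s + i) -> Q (s + i.-1).
  move=> ik Qi; apply/negPn/negP => nQi.
  have := start i 0; rewrite mul0n addn0 Qi => /(_ _ _ nQi _) h.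
  have /homogP : homog k w (s + i) by apply: h => //; lia.
  case=> [|c hc]; first by lia.
  have ca : c = la by rewrite -va hc //; lia.
  have ik1 : i = k.-1.
    apply/eqP; have : nth la w (s + i) != lb by rewrite hc ?ca //; lia.
    by apply: contraR => ?; rewrite vb //; lia.
  apply: (nocc (s + k - 2)); first by lia.
  left; apply/occ_uP; first by lia.
  split; [by lia | by rewrite vb //; lia | move=> n nl].
  by rewrite hc // ik1; lia.
have Q0 i : i < k -> ~~ Q (s + i).
  elim: i => [|i IHi] ik; first by rewrite addn0.
  by apply: contra (IHi (ltnW ik)) => /nostart; apply; lia.
have [||i ik /FP] := min_uncompletable_v (w := w) (s := s) _ minw ov; try lia.
by rewrite FQ; [apply/negP/Q0; lia | lia].
Qed.

Lemma homog_change (k : nat) (w : word) (j p : nat) :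
  j + k.-1 <= size w -> j <= p -> p.+1 < j + k.-1 ->
  nth la w p != nth la w p.+1 -> ~~ homog k w j.
Proof.
move=> jw jp pj; apply: contra => /homogP[//|c hc].
by apply/eqP; rewrite !hc //; lia.
Qed.

(** The factor of length [k] is [u] itself, and $ba^{k-2}$ is inhomogeneous: the only block readable
    at [s] has length [k - 1]. *)
Lemma forbidden_u (k : nat) (w : word) (s : nat) : 3 < k -> occ k w (u k) s ->
  forbidden k w s <-> forbidden k w (s + k.-1).
Proof.
move=> k3 ou; have [sw ws was] := (occ_uP w s (ltnW (ltnW (ltnW k3)))).1 ou.
have nh : ~~ homog k w s.
  by apply: (@homog_change k w s s) => //; try lia; rewrite ws was //; lia.
split=> [|Fk]; first by apply: forbidden_addk1 => //; lia.
apply/forbidden_step => //; first by lia.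
by split; [left; rewrite /occUVb (occE _ sw).1 | right].
Qed.

(** [g] is the rotation taking the window at [s] to the window at [t]. The last clause picks, in
    class [i], the representative among the [k] positions just before [t], with [x] its offset from
    [t - k]. *)
Lemma offset_class (k s t : nat) : 0 < k -> s + k <= t ->
  exists g, [/\ g < k, (t - s) %% k = g,
    forall (Q : nat -> bool) i, (forall j, Q (j + k) = Q j) ->
      Q (t + i) = Q (s + (g + i)) &
    forall i, i < k -> exists r x,
      [/\ x < k, s + i + r * k + k = t + x & i = g + x \/ i + k = g + x]].
Proof.
move=> k0 st; exists ((t - s) %% k).
have mk : 0 < (t - s) %/ k by rewrite divn_gt0 //; lia.
have := ltn_pmod (t - s) k0; have := divn_eq (t - s) k.
move: (_ %/ k) (_ %% k) mk => [//|m] g _ tE gk.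
have {}tE : t = s + g + m * k + k by rewrite mulSnr in tE; lia.
split=> // [Q i per|i ik].
  by rewrite -(@periodic_addM k Q (s + (g + i)) m.+1) // tE mulSnr; congr Q; lia.
have [gi|ig] := leqP g i; first by exists m, (i - g); split; lia.
by exists m.+1, (i + k - g); rewrite mulSnr; split; lia.
Qed.

Lemma run_shift (k s g e : nat) (Q : nat -> bool) :
  (forall j, Q (j + k) = Q j) -> (forall i, i < k -> Q (s + i) = (e <= i)) ->
  forall i, g < k -> i < k ->
    Q (s + (g + i)) = (e <= g + i < k) || (e + k <= g + i).
Proof.
move=> per eE i gk ik; have [gi|gi] := ltnP (g + i) k; first by rewrite eE //; lia.
by rewrite -[g + i](subnK gi) addnA per eE; lia.
Qed.

Lemma consecutive_uu (k : nat) (w : word) (s t : nat) (F : nat -> bool) :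
  3 < k -> (forall j, F j <-> forbidden k w j) ->
  s + k <= t -> occ k w (u k) s -> occ k w (u k) t ->
  (forall j, s < j < t -> ~ occUV k w j) ->
  \sum_(i < k) F (t + i) < \sum_(i < k) F (s + i) ->
  exists e, [/\ 1 < e < k,
    forall i, i < k -> F (s + i) = (i == 0) || (e <= i) &
    forall i, i < k -> F (t + i) = (0 < i) && (i <= k - e)].
Proof.
move=> k3 FP st ous out nocc lt.
have [tw tb ta] := (occ_uP w t (ltnW (ltnW (ltnW k3)))).1 out.
have [|Fs [Q [per Qs FQ start]]] := forbidden_excess _ FP tw st nocc lt.
  by lia.
clear lt.
have Fu r : occ k w (u k) r -> F r = F (r + k.-1).
  by move=> /(forbidden_u k3) Fr; apply/idP/idP => /FP/Fr/FP.
have [g [gk _ /(_ Q _ per) Qt cls]] := @offset_class k s t ltac:(lia) st.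
have Qt0 : Q t = Q (s + g) by have := Qt 0; rewrite !addn0.
have startE i : 0 < i < k -> Q (s + i) -> ~~ Q (s + i.-1) -> i = g.+1.
  move=> ik Qi nQi.
  have [|l [x [xk jE gx]]] := cls i; first by case/andP: ik.
  have := start i l; rewrite Qi => /(_ _ _ nQi _) h.
  have {h} : homog k w (s + i + l * k) by apply: h => //; lia.
  have sj : s < s + i + l * k by lia.
  move: (s + i + l * k) => j in jE sj *.
  (* Here [j = t - k + x]. For [x = 0], [forbidden_u] at [t] contradicts the start of a run; [x = 1]
     is the claim; for [x = 2], the factor ends with the [b] at [t], giving an intermediate [v]; for
     larger [x] it contains the change from [b] to [a] after [t]. *)
  case: x => [|[|[|x]]] in xk jE gx *.
  - have gi : i = g by lia.
    have : F t by rewrite FQ ?Qt0 -?gi //; lia.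
    rewrite (Fu t) // FQ ?Qt; last by lia.
    by rewrite (_ : s + _ = s + i.-1 + 1 * k) ?(periodic_addM _ _ per) ?(negPf nQi); lia.
  - by lia.
  - case/homogP=> [|c hc]; first by lia.
    have cb : c = lb by rewrite -tb hc //; lia.
    case: (nocc j); first by lia.
    right; apply/occ_vP; first by lia.
    split; [by lia | by rewrite ta //; lia | by rewrite -cb].
  - move=> hj; suff /negP[] : ~~ homog k w j by [].
    apply: (@homog_change k w j t); [lia | lia | lia |].
    by rewrite tb ta //; lia.
have [||i j ij jk Qi nQi Qj nQj|e [ek Qe nQe eE]] :=
    @single_run k (fun i => Q (s + i)).
- by rewrite addn0.
- by rewrite -FQ -?Fu //; lia.
- by have := startE i; have := startE j; rewrite Qi Qj nQi nQj; lia.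
have eg : e = g.+1 by apply: startE.
have Qsk : Q (s + k.-1) by rewrite -FQ -?Fu //; lia.
exists e; split.
(* If [g = 0], both windows lie in the same classes: [t] would be free like the class of [s], while
   [t + k - 1] is forbidden. *)
- suff : g != 0 by lia.
  apply/eqP => g0; have : Q t = false.
    by rewrite Qt0 g0 addn0 (negPf Qs).
  rewrite -FQ ?(Fu t) //; last by lia.
  by rewrite FQ ?Qt ?g0 ?Qsk //; lia.
- move=> [|i] ik; first by rewrite addn0.
  by rewrite FQ ?eE //; lia.
- move=> i ik; rewrite FQ ?Qt ?(run_shift per eE) //; clear -ik st ek gk eg; lia.
Qed.

Lemma ex_change (f : nat -> bool) (m n : nat) : m <= n -> ~~ f m -> f n ->
  exists p, [/\ m <= p < n, ~~ f p & f p.+1].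
Proof.
move=> mn fm; elim: n mn => [|n IHn] mn fn.
  by move: mn fm; rewrite leqn0 => /eqP->; rewrite fn.
have mn1 : m <= n by case: ltngtP mn fm => // ->; rewrite fn.
case fn': (f n); last by exists n; rewrite fn' mn1 /=.
by have [p [mp fp fp1]] := IHn mn1 fn'; exists p; split=> //; lia.
Qed.

(* A change of letter makes [k - 2] successive positions inhomogeneous, so that
   only two residue classes are left. *)
Lemma homog_classes (k : nat) (w : word) (s t p : nat) :
  1 < k -> s + k.-1 <= p < t -> t + k <= size w ->
  nth la w p != nth la w p.+1 ->
  exists h, forall i, 0 < i < k ->
    (forall r, s + i + r * k < t -> homog k w (s + i + r * k)) ->
    i = h \/ i = h.+1.
Proof.
move=> k1 sp tw change.
have [h [hk _ _ cls]] := @offset_class k s p.+1 ltac:(lia) ltac:(lia).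
exists h => i ik hom.
have [|r [x [xk jE hx]]] := cls i; first by case/andP: ik.
have [x1|x1] := leqP x 1; first by lia.
move: {hom} (hom r); move: (s + i + r * k) jE => j jE hom.
have /negP[] : ~~ homog k w j by apply: (@homog_change k w j p) => //; lia.
by apply: hom; lia.
Qed.

(** The letters pass from the final [a] of [u] to the initial [b] of [v], so [homog_classes] leaves
    two adjacent classes where a run may start. *)
Lemma consecutive_uv (k : nat) (w : word) (s t : nat) (F : nat -> bool) :
  3 < k -> (forall j, F j <-> forbidden k w j) ->
  s + k <= t -> occ k w (u k) s -> occ k w (v k) t ->
  (forall j, s < j < t -> ~ occUV k w j) ->
  \sum_(i < k) F (t + i) < \sum_(i < k) F (s + i) ->
  exists e g, [/\ 0 < e <= g, g < k, (t - s) %% k = g,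
    forall i, i < k -> F (s + i) = (i == 0) || (e <= i) &
    forall i, i < k -> F (t + i) = (i < k - g) || (e + k - g <= i)].
Proof.
move=> k3 FP st ous ovt nocc lt.
have [tw ta tb] := (occ_vP w t (ltnW (ltnW (ltnW k3)))).1 ovt.
have [_ sb sa] := (occ_uP w s (ltnW (ltnW (ltnW k3)))).1 ous.
have [|Fs [Q [per Qs FQ start]]] := forbidden_excess _ FP tw st nocc lt.
  by lia.
clear lt.
have [g [gk modE /(_ Q _ per) Qt _]] := @offset_class k s t ltac:(lia) st.
suff [e [eg Fse Fte]] : exists e, [/\ 0 < e <= g,
    forall i, i < k -> F (s + i) = (i == 0) || (e <= i) &
    forall i, i < k -> F (t + i) = (i < k - g) || (e + k - g <= i)].
  by exists e, g.
clear modE.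
have Qsk : Q (s + k.-1).
  by rewrite -FQ; [apply/FP/(forbidden_u k3 ous).1/FP | lia].
have [|||p [sp /negPf pa pb]] := @ex_change (nth la w) (s + k.-1) t.
- by lia.
- by rewrite sa //; lia.
- by rewrite tb //; lia.
have [||h startE] := @homog_classes k w s t p _ sp tw; first by lia.
  by rewrite pa pb.
have runE i : 0 < i < k -> Q (s + i) -> ~~ Q (s + i.-1) -> i = h \/ i = h.+1.
  move=> /[dup] ik /andP[i0 _] Qi nQi; apply: startE => // r rt.
  exact: start.
have [||i j ij jk Qi nQi Qj nQj|e [ek Qe nQe eE]] :=
    @single_run k (fun i => Q (s + i)).
- by rewrite addn0.
- by [].
- have [ik jk'] : 0 < i < k /\ 0 < j < k by clear -ij jk; lia.
  (* Adjacent classes cannot both start a run: the second start needs its predecessor outside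
     [Q]. *)
  case: (runE i ik Qi nQi) (runE j jk' Qj nQj) => ih [] jh;
    try by clear -ij ih jh; lia.
  by rewrite jh -ih Qi in nQj.
have Qti i : i < k -> Q (t + i) = (e <= g + i < k) || (e + k <= g + i).
  by move=> ik; rewrite Qt (run_shift per eE).
exists e.
have Ft : F t by apply/FP/forbidden_v => //; clear -k3; lia.
have tst : s < t < t + k by clear -st k3; lia.
have Qt0 : Q t by rewrite -FQ.
(* [t] is forbidden because of [v], so its class [g] belongs to the run. *)
have eg : 0 < e <= g by move: Qt0; rewrite -[t]addn0 Qti; clear -ek gk; lia.
split=> //.
- move=> [|i] ik; first by rewrite addn0.
  by rewrite FQ ?eE //; clear -ik st tw; lia.
- move=> i ik; rewrite FQ ?Qti //; clear -ik st eg gk; lia.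
Qed.

(** * Overlapping occurrences *)

(** The second word begins with [b], so it cannot start in the tail of [u] or at the last letter of
    [v]. Its own run of [b] must stop before the final [a] of the first [v], which leaves only [u]
    sharing the two letters [ba]. *)
Lemma overlapP (k : nat) (w : word) (s t : nat) : 2 < k ->
  occUV k w s -> occUV k w t -> s < t < s + k ->
  [/\ occ k w (v k) s, occ k w (u k) t & t = s + k - 2].
Proof.
move=> k2 os ot st; have k0 : 0 < k by lia.
have wt : nth la w t = lb.
  by case: ot => [/(occ_uP _ _ k0)[_ ->]|/(occ_vP _ _ k0)[_ _ ->]] //; lia.
case: os => [/(occ_uP _ _ k0)[_ _ as_]|/[dup] os /(occ_vP _ _ k0)[_ sa sb]].
  by rewrite as_ // in wt.
have tk : t != s + k.-1 by apply: contra_eqN wt => /eqP->; rewrite sa.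
case: ot => [/[dup] ot /(occ_uP _ _ k0)[_ _ ta]|/(occ_vP _ _ k0)[_ _ tb]].
  split=> //; have [//|tk2] := eqVneq t (s + k - 2).
  have : nth la w t.+1 = lb by rewrite sb //; clear -st tk tk2 k2; lia.
  by rewrite ta //; clear -k2; lia.
by move: sa; rewrite tb //; clear -st tk k2; lia.
Qed.

(** A nonempty finite set of integers united with its shift by one has at least one more element. *)
Lemma sum_pairs (n : nat) (a b : nat -> bool) :
  (forall i, i < n -> a i -> b i && b i.+1) ->
  \sum_(i < n) a i < \sum_(i < n.+1) b i \/
  \sum_(i < n) a i = 0 /\ (forall i, i <= n -> ~~ b i).
Proof.
elim: n => [|n IHn] ab.
  rewrite big_ord0 big_ord1 /=; case b0: (b 0); first by left.
  by right; split=> // i; rewrite leqn0 => /eqP->; rewrite b0.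
rewrite [\sum_(i < n.+1) a i]big_ord_recr [\sum_(i < n.+2) b i]big_ord_recr /=.
have abn := ab n (ltnSn n); case: IHn => [i ni|lt|[-> nb]].
- by apply: ab; apply: ltnW.
- by left; case: (a n) abn => [/(_ isT)/andP[_ ->]|_];
    rewrite ?ltn_add2r // addn0 ltn_addr.
- have -> : a n = false by apply/negP => /abn; rewrite (negPf (nb n _)).
  rewrite big1 => [|i _]; last by rewrite (negPf (nb i _)) // -ltnS.
  case bn: (b n.+1); [by left | right; split=> // i].
  by rewrite leq_eqVlt ltnS => /orP[/eqP->|/nb//]; rewrite bn.
Qed.

(** For [0 < i < k - 2] the factor at [s + i] is inhomogeneous and is neither [u] nor [v], so each
    forbidden [s + i] yields two adjacent forbidden positions of [q]. By [sum_pairs] this outweighs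
    the single gain at [s] unless there are none. *)
Lemma overlap_vu (k : nat) (w : word) (s t : nat) (F : nat -> bool) :
  3 < k -> (forall j, F j <-> forbidden k w j) -> min_uncompletable k w ->
  occ k w (v k) s -> occ k w (u k) t -> t = s + k - 2 ->
  \sum_(i < k) F (t + i) < \sum_(i < k) F (s + i) ->
  (forall i, i < k -> F (s + i) = (i == 0) || (i == k - 1)) /\
  (forall i, i < k -> F (t + i) = (i == 1)).
Proof.
move=> k3 FP minw ov ou tE lt.
have k0 : 0 < k by lia.
have [tw tb ta] := (occ_uP w t k0).1 ou.
have [sw sa sb] := (occ_vP w s k0).1 ov.
have Fs : F s by apply/FP/forbidden_v => //; lia.
have Ft : F t = F (t + k.-1).
  by apply/idP/idP => /FP/(forbidden_u k3 ou)/FP.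
have Fsi i : 0 < i -> i + 2 < k -> F (s + i) -> F (t + i.+1) && F (t + i.+2).
  move=> i0 ik /FP Fi.
  have iw : s + i + k <= size w by lia.
  have nh : ~~ homog k w (s + i).
    apply: (@homog_change k w _ (s + k - 2)); [lia | lia | lia |].
    have -> : (s + k - 2).+1 = s + k.-1 by clear -k3; lia.
    by rewrite sa sb //; clear -k3; lia.
  have nocc : ~ occUV k w (s + i).
    case=> [/(occ_uP _ _ k0)[_ _ /(_ (s + i).+1)]|/(occ_vP _ _ k0)[_ _ /(_ (s + k.-1))]].
      by rewrite sb //; lia.
    by rewrite sa => H; have := H ltac:(lia).
  apply/andP; split; apply/FP.
    rewrite (_ : t + _ = s + i + k.-1); last by lia.
    by apply: forbidden_addk1 => //; lia.
  rewrite (_ : t + _ = s + i + k); last by lia.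
  by apply: forbidden_addk => //; lia.
have noF x : 2 <= x < k -> ~~ F (t + x).
  move=> xk; have := @sum_pairs (k - 3) (fun i => F (s + i.+1)) (fun i => F (t + i.+2)).
  case=> [i ik|lt'|[_ nF]].
  - by move=> Fi; apply: (Fsi i.+1) => //; lia.
  - move: lt; have [n kE] : exists n, k = n.+3 by exists (k - 3); lia.
    have kn : k - 3 = n by lia.
    rewrite kn in lt'; rewrite kE.
    (* The last two positions of the first window are [t] and [t + 1], the first two of the second;
       their contributions cancel. *)
    have -> : \sum_(i < n.+3) F (s + i) =
        F s + (\sum_(i < n) F (s + i.+1) + F t + F (t + 1)).
      rewrite big_ord_recl 2!big_ord_recr /= addn0.
      congr (_ + (_ + nat_of_bool (F _) + nat_of_bool (F _)));
        by clear -tE kE; rewrite /bump; lia.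
    have -> : \sum_(i < n.+3) F (t + i) =
        F t + (F (t + 1) + \sum_(i < n.+1) F (t + i.+2)).
      by rewrite 2!big_ord_recl /= addn0.
    rewrite Fs; move: lt'.
    set A := \sum_(i < n) _; set B := \sum_(i < n.+1) _ => AB.
    by case: (F t); case: (F (t + 1)) => /=; clear -AB; lia.
  - by have := nF (x - 2); rewrite (_ : (x - 2).+2 = x); [apply; lia | lia].
have Ft0 : F t = false.
  by rewrite Ft; apply: negbTE; apply: noF; lia.
have Fs0 i : 0 < i -> i + 2 < k -> F (s + i) = false.
  move=> i0 ik; apply/negP => /(Fsi i i0 ik)/andP[_]; apply/negP; apply: noF; lia.
have Fs2 : F (s + (k - 2)) = false by rewrite (_ : s + _ = t) //; lia.
(* Minimality demands a forbidden local position other than 0 in [v]; only [k - 1], which is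
   [t + 1], is left. *)
have [||i ik /FP Fi] := min_uncompletable_v (w := w) (s := s) _ minw ov; try lia.
have ik1 : i = k - 1.
  have [//|ik1] := eqVneq i (k - 1); have [ik2|ik2] := eqVneq i (k - 2).
    by rewrite ik2 Fs2 in Fi.
  by rewrite Fs0 in Fi; lia.
have Ft1 : F (t + 1) by rewrite (_ : t + 1 = s + i) //; lia.
split=> [[|j] jk|[|[|j]] jk]; rewrite ?addn0 //.
- have [->|j1] := eqVneq j.+1 (k - 1); first by rewrite -ik1 Fi orbT.
  have [->|j2] := eqVneq j.+1 (k - 2); first by rewrite Fs2; clear -k3; lia.
  by rewrite Fs0 //; lia.
- by apply: negbTE; apply: noF; lia.
Qed.

(** * Overlapping and disjoint cases combined *)

Theorem theorem3 (k : nat) (w : seq bool) (s t : nat)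
    (Fp Fq : {set 'I_k}) :
  4 <= k ->
  min_uncompletable k w ->
  consecutive k w s t ->
  (forall i : 'I_k, i \in Fp <-> forbidden k w (s + i)) ->
  (forall i : 'I_k, i \in Fq <-> forbidden k w (t + i)) ->
  #|Fq| < #|Fp| ->
  (* (i) *)
  (occ k w (u k) s /\ occ k w (u k) t /\
   exists j, [/\ 1 <= j, j <= k - 2,
     Fp = [set x : 'I_k | (val x == 0) || (k - j <= x)] &
     Fq = [set x : 'I_k | (1 <= x) && (x <= j)]])
  \/
  (* (ii) *)
  ([/\ occ k w (v k) s, occ k w (u k) t, t < s + k,
     Fp = [set x : 'I_k | (val x == 0) || (val x == k - 1)] &
     Fq = [set x : 'I_k | val x == 1]])
  \/
  (* (iii) *)
  (occ k w (u k) s /\ occ k w (v k) t /\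
   exists i j : nat, [/\ i < j, j <= k & j != i.+1] /\
     [/\ Fq = [set x : 'I_k | (x <= i) || (j <= x)],
          Fp = [set x : 'I_k | (val x == 0) || (j - i - 1 <= x)] &
          ((t%:Z - (s + k)%:Z)%R = (k - 1 - i)%:Z %[mod k%:Z])%Z]).
Proof.
move=> k4 minw [os ot st only] FpP FqP.
have k0 : 0 < k by lia.
have [F FP] := @forbidden_pred k w ltac:(lia).
have Fp' i : i \in Fp <-> F (s + i) by rewrite FP.
have Fq' i : i \in Fq <-> F (t + i) by rewrite FP.
have FpE (i : 'I_k) : (i \in Fp) = F (s + i) by apply/idP/idP => /Fp'.
have FqE (i : 'I_k) : (i \in Fq) = F (t + i) by apply/idP/idP => /Fq'.
rewrite (card_sum Fp') (card_sum Fq') => lt.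
have [tsk|st'] := ltnP t (s + k).
  have [|ov ou tE] := @overlapP k w s t (ltnW k4) os ot; first by apply/andP.
  have [Fse Fte] := overlap_vu k4 FP minw ov ou tE lt.
  right; left; split=> //; apply/setP => i; rewrite inE.
    by rewrite FpE Fse.
  by rewrite FqE Fte.
have nocc j : s < j < t -> ~ occUV k w j.
  move=> sjt oj; case: only => [|/(_ j oj)]; first by rewrite ltnNge st'.
  by case/andP: sjt => sj jt; case; lia.
have tw : t + k <= size w by case: ot => -[].
case: os => [ous|ovs]; last first.
  by move: lt; rewrite ltnNge (consecutive_v k4 FP minw tw st' ovs nocc).
case: ot => [out|ovt]; [left | right; right]; do 2 split=> //.
  have [e [ek Fse Fte]] := consecutive_uu k4 FP st' ous out nocc lt.
  exists (k - e); split; [by lia | by lia | |]; apply/setP => i; rewrite inE.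
    by rewrite FpE Fse // subKn //; case/andP: ek => _ /ltnW.
  by rewrite FqE Fte.
have [e [g [/andP[e0 eg] gk modE Fse Fte]]] :=
  consecutive_uv k4 FP st' ous ovt nocc lt.
have ksub : k - 1 - (k - g - 1) = g by clear -gk; lia.
(* With these values [j - i - 1 = e], the start of the run in the window of [p], and
   [k - 1 - i = g], the residue of [t - s]. *)
exists (k - g - 1), (e + k - g); do ?split.
- by clear -gk e0 eg; lia.
- by clear -gk e0 eg; lia.
- by clear -gk e0 eg; lia.
- apply/setP => i; rewrite inE FqE Fte //; clear -gk e0 eg; lia.
- apply/setP => i; rewrite inE FpE Fse //=; clear -gk e0 eg; lia.
rewrite ksub -modE.
have -> : (t%:Z - (s + k)%:Z =
    (((t - s) %/ k)%:Z - 1) * k%:Z + ((t - s) %% k)%:Z)%R.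
  have := divn_eq (t - s) k; move: (_ %/ k) (_ %% k) => q r; clear -st'; nia.
by rewrite modzMDl.
Qed.
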